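(* Let $X$ be a discrete generalized ordered set and $Y$ any generalized ordered set. Then for all $(x,y),(x',y')\in X\times Y$, $(x,y)<(x',y')$ in the lexicographic order if and only if $(x,y)<_w(x',y')$ in the weak lexicographic order.
   Context: The setting is constructive mathematics: no use of the law of excluded middle. For a set with a binary relation $<$, write $x\leq_{P}y$ if for all $z$, $z<x$ implies $z<y$, and $y<z$ implies $x<z$. A generalized ordered set is a set with a binary relation $<$ that is asymmetric ($x<y$ implies $\neg(y<x)$), transitive ($x<y<z$ implies $x<z$) and positively antisymmetric ($x\leq_{P}y$ and $y\leq_{P}x$ imply $x=y$). $X$ is discrete if for all $x,y\in X$, $x<y$ or $x=y$ or $y<x$. The lexicographic order is: $(x,y)<(x',y')$ iff $x<x'$, or ($x=x'$ and $y<y'$). The weak lexicographic order is: $(x,y)<_w(x',y')$ iff (1) $x\leq_{P}x'$ in $X$; (2) $x=x'$ implies $y<y'$; and (3) $\neg(x=x')$ implies $x<x'$. *)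

(* Defs.v *)
(* The mathematics is constructive: sets are types, their equality is [eq],
   relations are Prop-valued, and no classical axiom is loaded. *)

Definition leP {X : Type} (lt : X -> X -> Prop) (x y : X) : Prop :=
  forall z : X, (lt z x -> lt z y) /\ (lt y z -> lt x z).

Record genOrderedSet : Type := GenOrderedSet {
  carrier :> Type;
  lt : carrier -> carrier -> Prop;
  lt_asym : forall x y : carrier, lt x y -> ~ lt y x;
  lt_trans : forall x y z : carrier, lt x y -> lt y z -> lt x z;
  lt_pos_antisym :
    forall x y : carrier, leP lt x y -> leP lt y x -> x = y
}.

Arguments lt {g} _ _.

Definition discrete (X : genOrderedSet) : Prop :=
  forall x y : X, lt x y \/ x = y \/ lt y x.

Definition lex {X Y : genOrderedSet} (p q : X * Y) : Prop :=
  lt (fst p) (fst q) \/ (fst p = fst q /\ lt (snd p) (snd q)).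

Definition weak_lex {X Y : genOrderedSet} (p q : X * Y) : Prop :=
  leP lt (fst p) (fst q) /\
  (fst p = fst q -> lt (snd p) (snd q)) /\
  (~ (fst p = fst q) -> lt (fst p) (fst q)).

(* Main.v *)
Require Import Defs.

(** Transitivity turns [lt] into [leP] and asymmetry makes it exclude equality, so a lexicographic
    inequality satisfies all three clauses of [weak_lex] ([lex_weak_lex]). Conversely, trichotomy in
    [X] decides whether the first coordinates are equal, and this selects the clause that yields a
    disjunct of [lex]. *)

Lemma lt_irrefl (X : genOrderedSet) (x : X) : ~ lt x x.
Proof. intros H; exact (lt_asym X x x H H). Qed.

Lemma lt_neq (X : genOrderedSet) (x y : X) : lt x y -> x <> y.
Proof. intros H E; subst y; exact (lt_irrefl X x H). Qed.

Lemma leP_refl (X : genOrderedSet) (x : X) : leP lt x x.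
Proof. intros z; split; intros H; exact H. Qed.

Lemma lt_leP (X : genOrderedSet) (x y : X) : lt x y -> leP lt x y.
Proof.
  intros H z; split; intros Hz.
  - exact (lt_trans X z x y Hz H).
  - exact (lt_trans X x y z H Hz).
Qed.

Lemma lex_weak_lex (X Y : genOrderedSet) (p q : X * Y) :
  lex p q -> weak_lex p q.
Proof.
  intros [H | [E H]].
  - split; [exact (lt_leP X _ _ H) | split].
    + intros E; destruct (lt_neq X _ _ H E).
    + intros _; exact H.
  - split; [rewrite E; apply leP_refl | split].
    + intros _; exact H.
    + intros N; destruct (N E).
Qed.

Theorem theorem28 (X Y : genOrderedSet) (HX : discrete X)
    (x x' : X) (y y' : Y) :
  lex (x, y) (x', y') <-> weak_lex (x, y) (x', y').
Proof.
  split; [apply lex_weak_lex |].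
  intros [_ [Heq Hneq]]; simpl in *.
  destruct (HX x x') as [H | [E | H]].
  - left; exact H.
  - right; exact (conj E (Heq E)).
  (* Though absurd, this case needs no refutation: [lt x' x] already makes [x] and [x'] distinct, so
     the third clause gives [lt x x']. *)
  - left; apply Hneq; intros E; exact (lt_neq X _ _ H (eq_sym E)).
Qed.
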